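(* Fix $k\ge2$. Assume that the distribution of $Z$ is aperiodic (the greatest common divisor of its support is $1$), that $\mathbb{E} Z=\infty$, and that $\mathbb{E}\min_{1\le i\le k} Z^{(i)}<\infty$, where $Z^{(1)},\dots,Z^{(k)}$ are independent copies of $Z$. Then, in the $k$-choice model, $\Lambda_n\to\infty$ almost surely.
   Context: Let $Z$ be a random variable on $\mathbb{N}=\{1,2,3,\dots\}$. Fix $k\ge2$ and let $(Z^{(1)}_n)_{n\ge1},\dots,(Z^{(k)}_n)_{n\ge1}$ be $k$ independent sequences of i.i.d. random variables, all distributed as $Z$ and mutually independent. The $k$-choice model: define $T_n=\{n\}$ for $n\le0$ and $T_n=\{n\}\cup\bigcup_{i=1}^k T_{n-Z^{(i)}_n}$ for $n\ge1$. Let $\mathcal{L}_n=T_n\cap\{0,-1,-2,\dots\}$ and $\Lambda_n=|\mathcal{L}_n|$. *)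

(* Defs.v *)
From HB Require Import structures.
From mathcomp Require Import all_boot all_order all_algebra.
From mathcomp Require Import all_classical all_reals all_analysis.
Set Implicit Arguments. Unset Strict Implicit. Unset Printing Implicit Defensive.
Import Order.TTheory GRing.Theory Num.Theory.
Local Open Scope classical_set_scope.
Local Open Scope ring_scope.

(* Membership in T_n for the k-choice model, given the (realised) values
   z i n = Z^{(i)}_n.  T_n = {n} for n <= 0 and
   T_n = {n} \cup \bigcup_i T_{n - z i n} for n >= 1; since z >= 1 this
   recursion is well founded and T_n is the least set with these closure
   properties, i.e. the inductive predicate below. *)
Inductive inT (k : nat) (z : 'I_k -> nat -> nat) : int -> int -> Prop :=
| inT_self (n : int) : inT z n n
| inT_step (n : int) (i : 'I_k) (m : int) :
    0 < n -> inT z (n - (z i `|n|%N)%:Z) m -> inT z n m.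

Definition inL (k : nat) (z : 'I_k -> nat -> nat) (n : nat) (m : int) : Prop :=
  m <= 0 /\ inT z n%:Z m.

Definition Lambda_to_infty (k : nat) (z : 'I_k -> nat -> nat) : Prop :=
  forall M : nat, exists N : nat, forall n : nat, (N <= n)%N ->
    exists s : seq int, [/\ uniq s, (M <= size s)%N & forall m, m \in s -> inL z n m].

Definition mutually_independent d (T : measurableType d) (R : realType)
    (P : probability T R) (I : eqType) (J : I -> Prop) (X : I -> T -> nat) : Prop :=
  forall (s : seq I) (B : I -> set nat), uniq s -> (forall a, a \in s -> J a) ->
    P (\big[setI/setT]_(a <- s) (X a @^-1` B a)) =
    (\prod_(a <- s) fine (P (X a @^-1` B a)))%:E.

(* Main.v *)
Require Import Defs.
From HB Require Import structures.
From mathcomp Require Import all_boot all_order all_algebra.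
From mathcomp Require Import all_classical all_reals all_analysis.
From mathcomp Require Import measurable_realfun zify lra.
Import Order.TTheory GRing.Theory Num.Theory.
Local Open Scope classical_set_scope.
Local Open Scope ring_scope.
Set Implicit Arguments. Unset Strict Implicit. Unset Printing Implicit Defensive.

(** Let S be the additive monoid generated by the support of Z; it contains all
    n >= N for some N.  Call r good if prescribed jumps lead from every r + j
    with j in S, j <= N + w, to r (a cylinder event), and if moreover every
    n > r + N + w has some jump of length at most n - (r + N).  Then r lies in T_n
    for all n >= r + N.  Since E min < oo, a union bound over the second condition
    shows that for large w the probability of being good is bounded below
    uniformly in r.  Being good depends only on the jumps at n > r, so it is
    independent of the event that the first jump at r has length at least r + K,
    whose probabilities sum to infinity because E Z = oo.  A decoupling
    estimate and Kolmogorov's zero-one law then show that almost surely, for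
    every K, some good r has a jump landing at or below -K; taking K successively
    larger produces arbitrarily many leaves lying in T_n for all large n. *)

(** * Deterministic part *)

Lemma inT_trans (k : nat) (z : 'I_k -> nat -> nat) (a b c : int) :
  inT z a b -> inT z b c -> inT z a c.
Proof. by move=> ab bc; elim: ab bc => // n i m n0 _ IH /IH; apply: inT_step. Qed.

(** Generators are added one at a time in front, so that inverting a membership proof yields a first
    jump. *)
Inductive semigroup_gen (S : set nat) : nat -> Prop :=
| sg_zero : semigroup_gen S 0
| sg_add (s n : nat) : S s -> semigroup_gen S n -> semigroup_gen S (s + n)%N.

Lemma semigroup_genD (S : set nat) (a b : nat) :
  semigroup_gen S a -> semigroup_gen S b -> semigroup_gen S (a + b)%N.
Proof.
by move=> Sa Sb; elim: Sa => // s n Ss _ IH; rewrite -addnA; apply: sg_add.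
Qed.

Lemma semigroup_genM (S : set nat) (a q : nat) :
  semigroup_gen S a -> semigroup_gen S (q * a)%N.
Proof.
move=> Sa; elim: q => [|q IH]; first exact: sg_zero.
by rewrite mulSn; apply: semigroup_genD.
Qed.

(* The least positive difference of two elements divides every generator,
   so it is 1; two consecutive elements b, b + 1 generate all n >= b ^ 2. *)
Lemma semigroup_gen_eventually (S : set nat) :
  (forall q : nat, (forall j, S j -> (q %| j)%N) -> q = 1%N) ->
  exists N : nat, forall n, (N <= n)%N -> semigroup_gen S n.
Proof.
move=> gcd1.
pose D (d : nat) := (0 < d)%N /\
  exists b, semigroup_gen S b /\ semigroup_gen S (d + b)%N.
have [s0 [Ss0 s0gt]] : exists s, S s /\ (0 < s)%N.
  (* Without a positive generator, [0] would divide all of them. *)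
  apply: contrapT => nS; suff : 0%N = 1%N by [].
  by apply: gcd1 => -[|j] Sj //; exfalso; apply: nS; exists j.+1.
have exD : exists d, `[< D d >].
  exists s0; apply/asboolP; split=> //; exists 0%N; split; first exact: sg_zero.
  by apply: sg_add => //; exact: sg_zero.
case: (ex_minnP exD) => d /asboolP[d0 [b [Sb Sdb]]] dmin.
have d1 : d = 1%N.
  (* A nonzero remainder [s %% d] is the difference of [s + (s %/ d) * b] and [(s %/ d) * (d + b)],
     both in the monoid, against the minimality of [d]. *)
  apply: gcd1 => s Ss; apply: contrapT => /negP; rewrite /dvdn -lt0n => r0.
  have /dmin : `[< D (s %% d)%N >].
    apply/asboolP; split => //; exists ((s %/ d) * (d + b))%N; split.
      exact: semigroup_genM.
    have -> : (s %% d + s %/ d * (d + b) = s + (s %/ d) * b)%N.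
      by rewrite {3}(divn_eq s d) mulnDr; lia.
    by apply: sg_add => //; exact: semigroup_genM.
  by rewrite leqNgt ltn_mod d0.
subst d; exists (b * b)%N => n bn.
have [b0|bgt] := posnP b.
  by rewrite -[n]muln1; apply: semigroup_genM; rewrite b0 in Sdb.
have qb : (b <= n %/ b)%N by rewrite leq_divRL.
have rb : (n %% b < b)%N by rewrite ltn_mod.
(* The remainder is less than [b], hence at most the quotient: that many copies of [b] are traded
   for [1 + b]. *)
have -> : n = ((n %/ b - n %% b) * b + (n %% b) * (1 + b))%N.
  by rewrite {1}(divn_eq n b); nia.
by apply: semigroup_genD; exact: semigroup_genM.
Qed.

(* r lies in T_n for all n >= r + N: inside the block (r, r + N + w] the jumps
   sigma lead to r, and beyond it some jump does not cross [r + N, r + N + w]. *)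
Definition good (k : nat) (i0 : 'I_k) (sigma : nat -> nat) (N w r : nat)
    (z : 'I_k -> nat -> nat) : Prop :=
  (forall j, (j < N + w)%N -> z i0 (r + j.+1)%N = sigma j.+1) /\
  (forall m, (w < m)%N -> exists i, (z i (r + N + m) <= m)%N).

(** Strong induction on [n]. Beyond the block, the short jump lands in [[r + N, n)]. Inside it, the
    offset [n - r >= N] lies in the monoid, and the jumps [sigma] decrease the offset within the
    monoid down to [0]. *)
Lemma good_inT (k : nat) (i0 : 'I_k) (S : set nat) (sigma : nat -> nat)
    (N w r : nat) (z : 'I_k -> nat -> nat) :
  (forall i n, (0 < n)%N -> (0 < z i n)%N) ->
  (forall n, (N <= n)%N -> semigroup_gen S n) ->
  (forall j, (0 < j)%N -> semigroup_gen S j ->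
     [/\ (0 < sigma j)%N, (sigma j <= j)%N & semigroup_gen S (j - sigma j)%N]) ->
  good i0 sigma N w r z ->
  forall n, (r + N <= n)%N -> inT z n%:Z r%:Z.
Proof.
move=> z0 SN Ssig [blk tl].
have inblk j : (j <= N + w)%N -> semigroup_gen S j -> inT z (r + j)%N%:Z r%:Z.
  elim/ltn_ind: j => -[|j] IH jle Sj; first by rewrite addn0; exact: inT_self.
  have [s0 sle Ss] := Ssig _ (ltn0Sn j) Sj.
  apply: (@inT_step _ _ _ i0); first by lia.
  rewrite absz_nat blk//.
  have -> : (r + j.+1)%N%:Z - (sigma j.+1)%:Z = (r + (j.+1 - sigma j.+1))%N%:Z by lia.
  by apply: IH => //; lia.
elim/ltn_ind => n IH rn.
have [nle|nlt] := leqP n (r + N + w)%N.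
  have -> : n = (r + (n - r))%N by lia.
  by apply: inblk; [lia|apply: SN; lia].
have [|i iz] := tl (n - (r + N))%N; first by lia.
have En : (r + N + (n - (r + N)) = n)%N by lia.
rewrite En in iz.
have zn := z0 i n ltac:(lia).
apply: (@inT_step _ _ _ i); first by lia.
rewrite absz_nat.
have -> : n%:Z - (z i n)%:Z = (n - z i n)%N%:Z by lia.
by apply: IH; lia.
Qed.

Lemma trunk_leaves (k : nat) (i0 : 'I_k) (N : nat) (z : 'I_k -> nat -> nat) :
  (forall K : nat, exists r : nat, [/\ (0 < r)%N, (r + K <= z i0 r)%N &
     forall n, (r + N <= n)%N -> inT z n%:Z r%:Z]) ->
  Lambda_to_infty z.
Proof.
move=> H M.
suff [N0 [s [us sM Hs]]] : exists N0 : nat, exists s : seq int,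
    [/\ uniq s, size s = M & forall n, (N0 <= n)%N -> forall m, m \in s -> inL z n m].
  exists N0 => n Nn; exists s; split=> //; first by rewrite sM.
  by move=> m ms; apply: (Hs n Nn).
elim: M => [|M [N0 [s [us sM Hs]]]]; first by exists 0%N, [::].
(* [K] exceeds the absolute value of every leaf found so far, so a leaf at or below [-K] is new. *)
pose K := (\sum_(m <- s) `|m|%N).+1.
have [r [r0 rK Hr]] := H K.
pose l : int := r%:Z - (z i0 r)%:Z.
have lK m : m \in s -> (`|m| < K)%N.
  by move=> ms; rewrite /K ltnS (big_rem m ms)/= leq_addr.
exists (maxn N0 (r + N)), (l :: s); split.
- rewrite /= us andbT; apply/negP => /lK; rewrite /l; lia.
- by rewrite /= sM.
- move=> n; rewrite geq_max => /andP[nN0 nr] m; rewrite inE => /orP[/eqP->|]; last exact: Hs.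
  split; first by rewrite /l; lia.
  apply: inT_trans (Hr n nr) _.
  by apply: (@inT_step _ _ _ i0); [lia|rewrite absz_nat; exact: inT_self].
Qed.

(** If [u r < p / 2], monotonicity keeps [p - u] above [p / 2] from then on, so each step loses at
    least [p / 2 * q s]; divergence would make [u] negative. *)
Lemma divergent_recursion_ge (R : realType) (u q : nat -> R) (p : R) :
  0 < p -> (forall r, 0 <= u r) -> (forall r, 0 <= q r) ->
  (forall r, u r.+1 <= u r) ->
  (forall r, u r.+1 + q r * (p - u r.+1) <= u r) ->
  (forall r (C : R), exists n, C < \sum_(r <= s < r + n) q s) ->
  forall r, (p / 2 <= u r).
Proof.
move=> p0 u0 q0 ud urec qdiv r; rewrite leNgt; apply/negP => ur.
have udec n : (u (r + n)%N <= u r).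
  by elim: n => [|n IH]; [rewrite addn0|rewrite addnS (le_trans (ud _))].
have Hn n : (u (r + n)%N + p / 2 * \sum_(r <= s < r + n) q s <= u r).
  elim: n => [|n IH]; first by rewrite addn0 big_geq// mulr0 addr0.
  rewrite addnS big_nat_recr/= ?leq_addr//.
  apply: le_trans IH; rewrite mulrDr addrA addrAC lerD2r.
  have := urec (r + n)%N; apply: le_trans; rewrite lerD2l mulrC.
  rewrite ler_wpM2l//; have := udec n.+1; rewrite addnS; lra.
have [n nC] := qdiv r (u r / (p / 2)).
have := Hn n; rewrite leNgt => /negP; apply.
have := u0 (r + n)%N; rewrite ltr_pdivrMr in nC; last by lra.
by rewrite mulrC in nC *; lra.
Qed.

(** * Independence and the zero-one law *)

(** The pi-system of finite-dimensional cylinders over [J], in the very form to which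
    [mutually_independent] applies. *)
Definition cyl (T : Type) (I : eqType) (X : I -> T -> nat) (J : set I) :
    set (set T) :=
  [set A | exists (s : seq I) (B : I -> set nat),
    [/\ uniq s, forall a, a \in s -> J a &
        A = \big[setI/setT]_(a <- s) (X a @^-1` B a)]].

Lemma bigsetI_seqE (T : Type) (I : eqType) (s : seq I) (F : I -> set T) :
  \big[setI/setT]_(a <- s) F a = [set w | forall a, a \in s -> F a w].
Proof.
elim: s => [|b s IH]; first by rewrite big_nil; apply/seteqP; split.
rewrite big_cons IH; apply/seteqP; split=> w /=.
  by move=> [Fb Fs] a; rewrite inE => /orP[/eqP->|/Fs].
by move=> H; split=> [|a as_]; apply: H; rewrite inE ?eqxx// as_ orbT.
Qed.

Lemma cyl_setI (T : Type) (I : eqType) (X : I -> T -> nat) (J : set I) :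
  setI_closed (cyl X J).
Proof.
move=> _ _ [s1 [B1 [u1 J1 ->]]] [s2 [B2 [u2 J2 ->]]].
(* Shared indices are listed once; each implication lifts the constraint of a list that lacks the
   index. *)
exists (undup (s1 ++ s2)), (fun a => [set x | (a \in s1 -> B1 a x) /\ (a \in s2 -> B2 a x)]).
split; first exact: undup_uniq.
  by move=> a; rewrite mem_undup mem_cat => /orP[/J1|/J2].
rewrite !bigsetI_seqE; apply/seteqP; split=> w /=.
  by move=> [H1 H2] a _; split=> [/H1|/H2].
by move=> H; split=> a as_; have := H a; rewrite mem_undup mem_cat as_ ?orbT => /(_ isT)[]; auto.
Qed.

Lemma cylS (T : Type) (I : eqType) (X : I -> T -> nat) (J J' : set I) :
  J `<=` J' -> cyl X J `<=` cyl X J'.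
Proof. by move=> JJ' A [s [B [us Js ->]]]; exists s, B; split=> // a /Js /JJ'. Qed.

Definition sigma_gen (T : Type) (I : eqType) (X : I -> T -> nat) (J : set I) :
  set (set T) := <<s cyl X J >>.

Lemma sigma_genS (T : Type) (I : eqType) (X : I -> T -> nat) (J J' : set I) :
  J `<=` J' -> sigma_gen X J `<=` sigma_gen X J'.
Proof. by move=> /(@cylS _ _ X) JJ'; exact: sub_smallest2r. Qed.

Lemma sigma_gen_preimage (T : Type) (I : eqType) (X : I -> T -> nat) (J : set I)
    (a : I) (B : set nat) : J a -> sigma_gen X J (X a @^-1` B).
Proof.
move=> Ja; apply: sub_sigma_algebra; exists [:: a], (fun=> B); split=> //.
  by move=> b; rewrite inE => /eqP->.
by rewrite big_seq1.
Qed.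

Lemma sigma_genC (T : Type) (I : eqType) (X : I -> T -> nat) (J : set I)
  (A : set T) : sigma_gen X J A -> sigma_gen X J (~` A).
Proof. by move=> sA; rewrite -setTD; apply: sigma_algebraCD. Qed.

Lemma sigma_gen_bigcup (T : Type) (I : eqType) (X : I -> T -> nat) (J : set I)
  (D : set nat) (A : (set T)^nat) : (forall n, D n -> sigma_gen X J (A n)) ->
  sigma_gen X J (\bigcup_(n in D) A n).
Proof.
move=> H; rewrite bigcup_mkcond; apply: sigma_algebra_bigcup => n.
case: ifPn => [/set_mem/H//|_]; exact: sigma_algebra0.
Qed.

Lemma sigma_gen_bigcap (T : Type) (I : eqType) (X : I -> T -> nat) (J : set I)
  (D : set nat) (A : (set T)^nat) : (forall n, D n -> sigma_gen X J (A n)) ->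
  sigma_gen X J (\bigcap_(n in D) A n).
Proof.
move=> H; rewrite -[V in sigma_gen _ _ V]setCK setC_bigcap.
by apply: sigma_genC; apply: sigma_gen_bigcup => n Dn; apply: sigma_genC; exact: H.
Qed.

Lemma sigma_genI (T : Type) (I : eqType) (X : I -> T -> nat) (J : set I)
  (A B : set T) : sigma_gen X J A -> sigma_gen X J B -> sigma_gen X J (A `&` B).
Proof.
move=> HA HB; rewrite -bigcap2E; apply: sigma_gen_bigcap => -[|[|n]] _ //=.
by rewrite -setC0; apply: sigma_genC; exact: sigma_algebra0.
Qed.

Lemma measurable_sigma_gen d (T : measurableType d) (I : eqType)
    (X : I -> T -> nat) (J : set I) :
  (forall a j, J a -> measurable (X a @^-1` [set j])) ->
  sigma_gen X J `<=` measurable.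
Proof.
move=> mX; apply: smallest_sub; first exact: sigma_algebra_measurable.
move=> _ [s [B [us Js ->]]]; rewrite big_seq.
apply: big_ind => [|? ? ? ?|a /Js Ja]; [exact: measurableT|exact: measurableI|].
have -> : X a @^-1` B a = \bigcup_(j in B a) (X a @^-1` [set j]).
  by apply/seteqP; split=> [w Bw|w [j Bj /= wj]]; [exists (X a w)|rewrite /preimage/= wj].
by apply: bigcup_measurable => j _; exact: mX.
Qed.

Local Open Scope ereal_scope.

(* For a fixed event A, the events independent of A form a Dynkin system. *)
Lemma pi_system_indep d (T : measurableType d) (R : realType)
    (P : probability T R) (G : set (set T)) (A : set T) :
  measurable A -> setI_closed G -> G `<=` measurable ->
  (forall B, G B -> P (A `&` B) = P A * P B) ->
  forall B, <<s G >> B -> P (A `&` B) = P A * P B.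
Proof.
move=> mA GI Gm GA B sB.
suff : <<s G >> `<=` [set B | measurable B /\ P (A `&` B) = P A * P B].
  by move=> /(_ _ sB)[].
apply: lambda_system_subset => //; last by move=> C GC; split; [exact: Gm|exact: GA].
apply/dynkin_lambda_system; split => [|C [mC PC]|F tF HF].
- by split=> //; rewrite setIT probability_setT mule1.
- split; first exact: measurableC.
  rewrite -setDE measureD//; last by rewrite (le_lt_trans (probability_le1 P mA))// ltry.
  transitivity (P A - P A * P C); first by rewrite -PC.
  rewrite probability_setC// muleBr ?mule1//; first exact: fin_num_measure.
- have mF k : measurable (F k) by case: (HF k).
  split; first exact: bigcup_measurable.
  rewrite setI_bigcupr measure_bigcup//; last 2 first.
    by move=> k _; exact: measurableI.
    by move=> i j _ _ [w [[_ Fi] [_ Fj]]]; apply: tF => //; exists w.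
  have fA : P A \is a fin_num by exact: fin_num_measure.
  rewrite measure_bigcup// -[P A]fineK// -nneseriesZl//.
  by apply: eq_eseriesr => k _; rewrite fineK//; case: (HF k).
Qed.

(** Two passes of [pi_system_indep]: first [A] is reduced to a cylinder with [B] fixed, then [B]
    with that cylinder fixed. *)
Lemma sigma_gen_indep d (T : measurableType d) (R : realType)
    (P : probability T R) (I : eqType) (J : set I) (X : I -> T -> nat)
    (J1 J2 : set I) (A B : set T) :
  (forall a j, J a -> measurable (X a @^-1` [set j])) ->
  mutually_independent P J X ->
  J1 `<=` J -> J2 `<=` J -> J1 `&` J2 `<=` set0 ->
  sigma_gen X J1 A -> sigma_gen X J2 B -> P (A `&` B) = P A * P B.
Proof.
move=> mX indX J1J J2J J120 sA sB.
have mJ J' : J' `<=` J -> sigma_gen X J' `<=` measurable.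
  by move=> J'J; apply: measurable_sigma_gen => a j /J'J; exact: mX.
have mc J' : J' `<=` J -> cyl X J' `<=` measurable.
  by move=> J'J C cC; apply: mJ J'J _ _; exact: sub_sigma_algebra.
rewrite setIC muleC.
move: A sA; apply: pi_system_indep; [exact: mJ J2J _ sB|exact: cyl_setI|exact: mc|].
move=> A cA; rewrite setIC muleC.
move: B sB; apply: pi_system_indep; [exact: mc cA|exact: cyl_setI|exact: mc|].
move=> _ [s2 [B2 [u2 Js2 ->]]]; case: cA => [s1 [B1 [u1 Js1 ->]]].
have disj a : a \in s1 -> a \in s2 -> False.
  by move=> /Js1 ? /Js2 ?; apply: (J120 a).
(* The index lists are disjoint, so both prescriptions glue into one cylinder over [s1 ++ s2]. *)
pose C a := if a \in s1 then B1 a else B2 a.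
have e1 : {in s1, C =1 B1} by move=> a as1; rewrite /C as1.
have e2 : {in s2, C =1 B2}.
  by move=> a as2; rewrite /C; case: ifP => // /disj /(_ as2).
have -> : \big[setI/setT]_(a <- s1) (X a @^-1` B1 a) = \big[setI/setT]_(a <- s1) (X a @^-1` C a).
  by apply: eq_big_seq => a /e1 ->.
have -> : \big[setI/setT]_(a <- s2) (X a @^-1` B2 a) = \big[setI/setT]_(a <- s2) (X a @^-1` C a).
  by apply: eq_big_seq => a /e2 ->.
rewrite -big_cat !indX// ?big_cat ?EFinM//=.
- rewrite cat_uniq u1 u2 andbT; apply/hasPn => a as2; apply/negP => as1.
  exact: disj as1 as2.
- by move=> a; rewrite mem_cat => /orP[/Js1/J1J|/Js2/J2J].
- by move=> a /Js2 /J2J.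
- by move=> a /Js1 /J1J.
Qed.

(** A cylinder involves finitely many indices, all of rank below some [n], hence is independent of
    [A]. So [A] is independent of the whole generated sigma-algebra, in particular of itself. *)
Lemma kolmogorov01 d (T : measurableType d) (R : realType)
    (P : probability T R) (I : eqType) (J : set I) (X : I -> T -> nat)
    (rank : I -> nat) (A : set T) :
  (forall a j, J a -> measurable (X a @^-1` [set j])) ->
  mutually_independent P J X ->
  (forall n, sigma_gen X (J `&` [set a | (n <= rank a)%N]) A) ->
  0 < P A -> P A = 1.
Proof.
move=> mX indX tA PA0.
have sA : sigma_gen X J A by apply: sigma_genS (tA 0%N); exact: subIsetl.
have mA : measurable A by exact: measurable_sigma_gen mX _ sA.
have fA : P A \is a fin_num by exact: fin_num_measure.
have PAA : P (A `&` A) = P A * P A.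
  apply: (pi_system_indep (G := cyl X J)) => //; first exact: cyl_setI.
    by move=> C cC; apply: (measurable_sigma_gen mX); exact: sub_sigma_algebra.
  move=> _ [s [B [us Js ->]]].
  pose n := (\max_(a <- s) rank a).+1.
  rewrite setIC muleC.
  apply: (sigma_gen_indep (J1 := J `&` [set a | (rank a < n)%N]) mX indX _ _ _ _ (tA n)).
  - exact: subIsetl.
  - exact: subIsetl.
  - by move=> a [[_ /= an] [_ /=]]; rewrite leqNgt an.
  - apply: sub_sigma_algebra; exists s, B; split=> // a as_; split; first exact: Js.
    by rewrite /= ltnS (big_rem a as_) leq_maxl.
move: PAA; rewrite setIid -(fineK fA) -EFinM => -[].
move/eqP; rewrite -subr_eq0 -{1}[fine (P A)]mulr1 -mulrBr mulf_eq0 => /orP[/eqP E|].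
  by move: PA0; rewrite -(fineK fA) E ltxx.
by rewrite subr_eq0 => /eqP <-.
Qed.

(** [N w] is the sum over [c] of the indicators of [c < N w]; sum and integral are exchanged. *)
Lemma expectation_nat_tail d (T : measurableType d) (R : realType)
    (P : probability T R) (N : T -> nat) :
  (forall c : nat, measurable [set w | (c < N w)%N]) ->
  \int[P]_w ((N w)%:R : R)%:E = \sum_(c <oo) P [set w | (c < N w)%N].
Proof.
move=> mN.
have NE w : ((N w)%:R : R)%:E = \sum_(c <oo) (\1_[set w | (c < N w)%N] w : R)%:E.
  rewrite (nneseries_split 0%N (N w)); last by move=> c _; rewrite lee_fin.
  rewrite eseries0 ?adde0; last first.
    by move=> c; rewrite add0n => Nc _; rewrite indicE memNset//= ltnNge Nc.
  rewrite add0n (eq_big_nat _ _ (F2 := fun=> 1)); last first.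
    by move=> c /andP[_ cN]; rewrite indicE mem_set.
  by rewrite sumEFin sumr_const_nat subn0.
under eq_integral do rewrite NE.
rewrite integral_nneseries//; last first.
  by move=> c; apply/measurable_EFinP; exact: measurable_indic.
by apply: eq_eseriesr => c _; rewrite integral_indic// setIT.
Qed.

Lemma preimage_law d (T : measurableType d) (R : realType)
    (P : probability T R) (X Y : T -> nat) (B : set nat) :
  (forall j, measurable (X @^-1` [set j])) ->
  (forall j, measurable (Y @^-1` [set j])) ->
  (forall j, P (X @^-1` [set j]) = P (Y @^-1` [set j])) ->
  P (X @^-1` B) = P (Y @^-1` B).
Proof.
move=> mX mY XY.
have E (V : T -> nat) : V @^-1` B = \bigcup_(j in B) (V @^-1` [set j]).
  by apply/seteqP; split=> [w Bw|w [j Bj /= wj]]; [exists (V w)|rewrite /preimage/= wj].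
rewrite (E X) (E Y) !measure_bigcup//.
- by apply: eq_eseriesr => j _; exact: XY.
- by apply/trivIsetP => i j _ _ ij; apply/seteqP; split=> // w [/= wi wj]; move: ij; rewrite -wi wj eqxx.
- by apply/trivIsetP => i j _ _ ij; apply/seteqP; split=> // w [/= wi wj]; move: ij; rewrite -wi wj eqxx.
Qed.

Lemma nneseries_pinfty_tail (R : realType) (f : nat -> R) (r : nat) (C : R) :
  (forall n, 0 <= f n)%R -> \sum_(s <oo) (f s)%:E = +oo ->
  exists n, (C < \sum_(r <= s < r + n) f s)%R.
Proof.
move=> f0 fy; apply: contrapT => nC.
have tailC : \sum_(r <= s <oo) (f s)%:E <= C%:E.
  apply: lime_le; first by apply: is_cvg_nneseries => n _ _; rewrite lee_fin.
  exists r => //= m rm; rewrite sumEFin lee_fin leNgt; apply/negP => Cm.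
  by apply: nC; exists (m - r)%N; rewrite subnKC.
have : \sum_(s <oo) (f s)%:E < +oo.
  rewrite (nneseries_split 0%N r); last by move=> n _; rewrite lee_fin.
  rewrite add0n sumEFin lte_add_pinfty ?ltry//.
  by rewrite (le_lt_trans tailC) ?ltry.
by rewrite fy ltxx.
Qed.

(* With U_r the union of the F_s `&` G_s over s >= r, independence gives
   P U_r >= P U_(r+1) + P F_r * (p - P U_(r+1)); since the P F_r are not summable
   this forces P U_r >= p / 2, and the zero-one law applies to the limsup. *)
Lemma limsup_decoupled d (T : measurableType d) (R : realType)
    (P : probability T R) (I : eqType) (J : set I) (X : I -> T -> nat)
    (rank : I -> nat) (F G : (set T)^nat) (p : R) :
  (forall a j, J a -> measurable (X a @^-1` [set j])) ->
  mutually_independent P J X ->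
  (forall r, sigma_gen X (J `&` [set a | rank a = r]) (F r)) ->
  (forall r, sigma_gen X (J `&` [set a | (r < rank a)%N]) (G r)) ->
  (0 < p)%R -> (forall r, p%:E <= P (G r)) ->
  \sum_(r <oo) P (F r) = +oo ->
  P (lim_sup_set (fun r => F r `&` G r)) = 1.
Proof.
move=> mX indX sF sG p0 pG Fy.
pose tl n := J `&` [set a | (n <= rank a)%N].
pose U n := \bigcup_(s >= n) (F s `&` G s).
have sFG r n : (n <= r)%N -> sigma_gen X (tl n) (F r `&` G r).
  move=> nr; apply: sigma_genI.
    by apply: sigma_genS (sF r) => a [Ja /= ar]; split=> //=; rewrite ar.
  by apply: sigma_genS (sG r) => a [Ja /= ar]; split=> //=; rewrite (leq_trans nr)// ltnW.
have sU n m : (n <= m)%N -> sigma_gen X (tl n) (U m).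
  by move=> nm; apply: sigma_gen_bigcup => r /= mr; apply: sFG; exact: leq_trans mr.
have Udec n m : (n <= m)%N -> U m `<=` U n.
  by move=> nm; apply: bigcup_subset => r /=; exact: leq_trans.
have ms J' A : J' `<=` J -> sigma_gen X J' A -> measurable A.
  by move=> J'J; apply: measurable_sigma_gen => a j /J'J; exact: mX.
have mU n : measurable (U n) by apply: ms (sU n n (leqnn n)); exact: subIsetl.
have mF n : measurable (F n) by apply: ms (sF n); exact: subIsetl.
have mG n : measurable (G n) by apply: ms (sG n); exact: subIsetl.
have fP A : measurable A -> P A \is a fin_num by move=> ?; exact: fin_num_measure.
have Ugep r : (p / 2 <= fine (P (U r)))%R.
  apply: (@divergent_recursion_ge _ (fun r => fine (P (U r))) (fun r => fine (P (F r)))) => //.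
  - by move=> n; rewrite fine_ge0.
  - by move=> n; rewrite fine_ge0.
  - by move=> n; rewrite fine_le ?fP// le_measure ?inE//; exact: Udec.
  - move=> n.
    have mGU : measurable (G n `\` U n.+1) by exact: measurableD.
    (* [F n] depends on indices of rank [n], while [G n] and [U n.+1] depend on larger ranks. *)
    have PF : P (F n `&` (G n `\` U n.+1)) = P (F n) * P (G n `\` U n.+1).
      apply: (sigma_gen_indep mX indX _ _ _ (sF n) (J2 := tl n.+1)).
      + exact: subIsetl.
      + exact: subIsetl.
      + by move=> a [[_ /= an] [_ /=]]; rewrite an ltnn.
      + rewrite setDE; apply: sigma_genI; first exact: sG.
        by apply: sigma_genC; exact: sU.
    have GU : p%:E <= P (G n `\` U n.+1) + P (U n.+1).
      apply: le_trans (pG n) _.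
      apply: (@le_trans _ _ (P ((G n `\` U n.+1) `|` U n.+1))).
        rewrite le_measure ?inE//; first exact: measurableU.
        by move=> w Gw; case: (pselect (U n.+1 w)) => Uw; [right|left].
      by rewrite measureU2.
    have UU : P (F n `&` (G n `\` U n.+1)) + P (U n.+1) <= P (U n).
      rewrite -measureU//; last 2 first.
        exact: measurableI.
        by apply/seteqP; split=> // w [[_ []]].
      rewrite le_measure ?inE//; first by apply: measurableU => //; exact: measurableI.
      move=> w [[Fw [Gw _]]|]; first by exists n => /=.
      exact: Udec.
    move: GU UU; rewrite PF -(fineK (fP _ mGU)) -(fineK (fP _ (mF n)))
      -(fineK (fP _ (mU n))) -(fineK (fP _ (mU n.+1))) -EFinM -!EFinD !lee_fin => GU.
    apply: le_trans => /=; rewrite addrC lerD2r ler_wpM2l ?fine_ge0//; lra.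
  - move=> n C; apply: nneseries_pinfty_tail => [m|]; first by rewrite fine_ge0.
    by rewrite -Fy; apply: eq_eseriesr => m _; rewrite fineK ?fP.
have mL : measurable (lim_sup_set (fun r => F r `&` G r)).
  by apply: bigcapT_measurable => n; exact: mU.
apply: (kolmogorov01 mX indX (rank := rank)).
  (* As [U] decreases, intersecting only from [n] on gives the same set: a tail event. *)
  move=> n; rewrite (_ : lim_sup_set _ = \bigcap_(m in [set m | (n <= m)%N]) U m).
    by apply: sigma_gen_bigcap => m; exact: sU.
  apply/seteqP; split=> [w Lw m _|w Lw m _]; first exact: Lw.
  have [nm|mn] := leqP n m; first exact: Lw.
  by apply: (Udec m n (ltnW mn)); exact: (Lw n (leqnn n)).
have /cvg_lim <- // : P \o U @ \oo --> P (lim_sup_set (fun r => F r `&` G r)).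
  apply: lim_sup_set_cvg; first by move=> n; exact: measurableI.
  by rewrite (le_lt_trans (probability_le1 P (mU 0%N)))// ltry.
apply: (@lt_le_trans _ _ (p / 2)%:E); first by rewrite lte_fin divr_gt0.
apply: lime_ge.
  apply: ereal_nonincreasing_is_cvgn => n m nm /=.
  by rewrite le_measure ?inE//; exact: Udec.
by apply: nearW => n /=; rewrite -(fineK (fP _ (mU n))) lee_fin.
Qed.

(** * Good times *)

(** The index [i0] makes the family nonempty, so the minimum is attained and is a natural number
    [M w]; then [c < M w] means that all [Y i w] exceed [c]. *)
Lemma expectation_min_tail d (T : measurableType d) (R : realType)
    (P : probability T R) (k : nat) (i0 : 'I_k) (Y : 'I_k -> T -> nat) :
  (forall c : nat, measurable [set w | forall i, (c < Y i w)%N]) ->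
  \int[P]_w (\big[mine/+oo]_(i < k) ((Y i w)%:R : R)%:E) =
  \sum_(c <oo) P [set w | forall i, (c < Y i w)%N].
Proof.
move=> mY.
pose M w := Y [arg min_(i < i0) ((Y i w)%:R : R)%:E]%O w.
have ME w : \big[mine/+oo]_(i < k) ((Y i w)%:R : R)%:E = ((M w)%:R : R)%:E.
  by rewrite (bigmin_eq_arg _ i0)// => i _; rewrite leey.
have SE c : [set w | (c < M w)%N] = [set w | forall i, (c < Y i w)%N].
  apply/seteqP; split=> w /=; last exact.
  rewrite /M; case: arg_minP => // i _ imin ci j.
  by apply: leq_trans ci _; have := imin j isT; rewrite lee_fin ler_nat.
under eq_integral do rewrite ME.
rewrite expectation_nat_tail; first by apply: eq_eseriesr => c _; rewrite SE.
by move=> c; rewrite SE.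
Qed.

Lemma nneseries_tail_small (R : realType) (f : (\bar R)^nat) (e : R) :
  (forall n, 0 <= f n) -> \sum_(n <oo) f n < +oo -> (0 < e)%R ->
  exists N, \sum_(N.+1 <= n <oo) f n <= e%:E.
Proof.
move=> f0 fy e0; apply: contrapT => H.
have c0 := nneseries_tail_cvg fy (fun n _ => f0 n).
have : e%:E <= 0 :> \bar R.
  rewrite -(cvg_lim _ c0)//; apply: lime_ge; first by apply/cvg_ex; exists 0.
  exists 1%N => // -[|n] //= _; rewrite leNgt; apply/negP => lt.
  by apply: H; exists n; exact: ltW.
by rewrite lee_fin leNgt e0.
Qed.

Lemma nneseries_pinfty_shift (R : realType) (f : (\bar R)^nat) (K : nat) :
  (forall n, 0 <= f n) -> (forall n, f n < +oo) -> \sum_(n <oo) f n = +oo ->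
  \sum_(n <oo) f (n + K)%N = +oo.
Proof.
move=> f0 ffin fy; rewrite nneseries_addn//; apply/eqP; rewrite -leye_eq leNgt.
apply/negP => lt; suff : \sum_(n <oo) f n < +oo by rewrite fy ltxx.
rewrite (nneseries_split 0%N K)// lte_add_pinfty//.
by rewrite add0n; apply: lte_sum_pinfty => i _; exact: ffin.
Qed.

Lemma semigroup_gen_pred (S : set nat) (n : nat) :
  semigroup_gen S n -> (0 < n)%N ->
  exists s, [/\ S s, (s <= n)%N & semigroup_gen S (n - s)%N].
Proof.
by case=> // s m Ss Sm _; exists s; split; rewrite ?leq_addr ?addKn.
Qed.

(** The block event has probability [beta > 0], a finite product independent of [r]; the event on
    later times has probability at least [1 / 2] by a union bound. They concern disjoint sets of
    times, whence [p = beta / 2]. *)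
Lemma prob_good_ge d (T : measurableType d) (R : realType)
    (P : probability T R) (k : nat) (i0 : 'I_k) (Z : T -> nat)
    (X : 'I_k -> nat -> T -> nat) (sigma : nat -> nat) (N w0 : nat) :
  (forall i n j, (0 < n)%N -> measurable (X i n @^-1` [set j])) ->
  (forall i n (B : set nat), (0 < n)%N -> P (X i n @^-1` B) = P (Z @^-1` B)) ->
  mutually_independent P (fun a : 'I_k * nat => (0 < a.2)%N)
    (fun a => X a.1 a.2) ->
  (forall j, 0 < P (Z @^-1` [set sigma j])) ->
  \sum_(w0.+1 <= m <oo) P [set w | forall i, (m < X i 1%N w)%N] <= (1 / 2 : R)%:E ->
  exists2 p : R, (0 < p)%R & forall r,
    p%:E <= P [set w | good i0 sigma N w0 r (fun i n => X i n w)] /\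
    sigma_gen (fun a : 'I_k * nat => X a.1 a.2) [set a | (r < a.2)%N]
      [set w | good i0 sigma N w0 r (fun i n => X i n w)].
Proof.
move=> mX lawX indX sig0 sumg.
pose J := [set a : 'I_k * nat | (0 < a.2)%N].
pose Xf := fun a : 'I_k * nat => X a.1 a.2.
have mXf a j : J a -> measurable (Xf a @^-1` [set j]) by move=> /= Ja; exact: mX.
pose bad r m := [set w | forall i, (m < X i (r + N + m)%N w)%N].
pose blk r := [set w | forall j, (j < N + w0)%N -> X i0 (r + j.+1)%N w = sigma j.+1].
pose tl r := ~` \bigcup_(m in ~` `I_w0.+1) bad r m.
have goodE r : [set w | good i0 sigma N w0 r (fun i n => X i n w)] = blk r `&` tl r.
  apply/seteqP; split=> w [Hb Ht]; split=> //.
    move=> [m /= /negP]; rewrite -leqNgt => wm bm; have [i] := Ht m wm.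
    by rewrite leqNgt bm.
  move=> m wm; apply: contrapT => nex; apply: Ht; exists m.
    by apply/negP; rewrite -leqNgt.
  by move=> i; rewrite ltnNge; apply/negP => le; apply: nex; exists i.
pose row (n : nat) := [seq (i, n) | i <- enum 'I_k].
have rowE n m : [set w | forall i, (m < X i n w)%N] =
    \big[setI/setT]_(a <- row n) (Xf a @^-1` [set x | (m < x)%N]).
  rewrite bigsetI_seqE; apply/seteqP; split=> w H; first by move=> _ /mapP[i _ ->]; exact: H.
  by move=> i; apply: (H (i, n)); apply: map_f; rewrite mem_enum.
have rowu n : uniq (row n) by rewrite map_inj_uniq ?enum_uniq// => i j [].
have sbad (J' : set ('I_k * nat)) n m : (forall i, J' (i, n)) ->
    sigma_gen Xf J' [set w | forall i, (m < X i n w)%N].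
  move=> J'n; apply: sub_sigma_algebra; exists (row n), (fun=> [set x | (m < x)%N]).
  by split=> // _ /mapP[i _ ->].
(* The value does not depend on [n], so row [r + N + m] can be compared with row [1], uniformly in
   [r]. *)
have Pbad n m : (0 < n)%N -> P [set w | forall i, (m < X i n w)%N] =
    (\prod_(i <- enum 'I_k) fine (P (Z @^-1` [set x | (m < x)%N])))%:E.
  move=> n0; rewrite rowE indX//; last by move=> _ /mapP[i _ ->].
  by rewrite big_map; congr EFin; apply: eq_bigr => i _; rewrite lawX.
have mbad r m : (0 < r + N + m)%N -> measurable (bad r m).
  by move=> ?; apply: (measurable_sigma_gen mXf); apply: sbad.
have stl r : sigma_gen Xf [set a | (r + (N + w0) < a.2)%N] (tl r).
  apply: sigma_genC; apply: sigma_gen_bigcup => m /= /negP; rewrite -leqNgt => wm.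
  by apply: sbad => i /=; rewrite -addnA ltn_add2l ltn_add2l.
pose s r := [seq (i0, r + j.+1)%N | j <- iota 0 (N + w0)].
have su r : uniq (s r) by rewrite map_inj_uniq ?iota_uniq// => i j [] /addnI[].
have blkE r : blk r = \big[setI/setT]_(a <- s r) (Xf a @^-1` [set sigma (a.2 - r)%N]).
  rewrite bigsetI_seqE; apply/seteqP; split=> w H.
    move=> _ /mapP[j jN ->]; rewrite /Xf/= addKn; apply: H.
    by move: jN; rewrite mem_iota.
  move=> j jN; have := H (i0, r + j.+1)%N; rewrite /Xf/= addKn; apply.
  by apply: map_f; rewrite mem_iota.
have sblk r : sigma_gen Xf [set a | (r < a.2 <= r + (N + w0))%N] (blk r).
  apply: sub_sigma_algebra; exists (s r), (fun a => [set sigma (a.2 - r)%N]).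
  split=> // _ /mapP[j + ->]; rewrite mem_iota /= => jN.
  by rewrite addnS ltnS leq_addr/= -addnS leq_add2l.
pose beta := (\prod_(j <- iota 0 (N + w0)) fine (P (Z @^-1` [set sigma j.+1])))%R.
have Pblk r : P (blk r) = beta%:E.
  rewrite blkE indX//; last by move=> _ /mapP[j _ ->] /=; rewrite addnS.
  rewrite big_map; congr EFin; apply: eq_bigr => j _.
  by rewrite /Xf/= addKn lawX// addnS.
have beta0 : (0 < beta)%R.
  apply: (big_ind (fun x : R => (0 < x)%R)) => [//|? ? ? ?|j _]; first exact: mulr_gt0.
  rewrite fine_gt0// sig0/=; have <- := lawX i0 1%N [set sigma j.+1] isT.
  by rewrite (le_lt_trans (probability_le1 P _)) ?ltry//; exact: mX.
have mtl r : measurable (tl r).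
  apply: (measurable_sigma_gen _ (stl r)) => a j /= aw; apply: mX.
  exact: leq_ltn_trans aw.
have Ptl r : (1 / 2 : R)%:E <= P (tl r).
  have mC : measurable (~` tl r) by exact: measurableC.
  have : P (~` tl r) <= (1 / 2 : R)%:E.
    apply: le_trans sumg.
    (* Emptying the terms with [m <= w0] keeps every [F m] measurable: [bad r m] could otherwise
       involve time [0], where nothing is assumed of [X]. *)
    pose F m := if (w0 < m)%N then bad r m else set0.
    have mF m : measurable (F m).
      by rewrite /F; case: ifPn => // wm; apply: mbad; rewrite addn_gt0 (leq_trans _ wm) ?orbT.
    apply: le_trans (measure_sigma_subadditive_tail (F := F) (N := w0.+1) P mF mC _) _.
      rewrite setCK => w [m /= wm bm]; exists m => //.
      by move/negP: wm; rewrite /F -leqNgt => ->.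
    apply: lee_nneseries => // m _.
    rewrite /F; case: ifPn => wm; last by rewrite measure0.
    suff <- : P (bad r m) = P [set w | forall i, (m < X i 1%N w)%N] by exact: lexx.
    by rewrite /bad !Pbad// addn_gt0 (leq_trans _ wm) ?orbT.
  rewrite probability_setC// -(fineK (fin_num_measure P _ (mtl r))) -EFinB !lee_fin.
  lra.
exists (beta * (1 / 2))%R; first by rewrite mulr_gt0// divr_gt0.
move=> r; rewrite goodE; split.
  rewrite (sigma_gen_indep mXf indX _ _ _ (sblk r) (stl r)).
  - by rewrite EFinM Pblk lee_wpmul2l// lee_fin ltW.
  - by move=> a /= /andP[ra _]; exact: leq_ltn_trans ra.
  - by move=> a /= ra; exact: leq_ltn_trans ra.
  - by move=> a [/= /andP[_ ?]]; rewrite ltnNge => /negP.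
apply: sigma_genI.
  by apply: sigma_genS (sblk r) => a /= /andP[].
by apply: sigma_genS (stl r) => a /=; apply: leq_ltn_trans; rewrite leq_addr.
Qed.

(* Almost sure divergence of the number of leaves *)
Local Close Scope ereal_scope.
Unset Implicit Arguments.

Theorem mainTheorem13 (d : measure_display) (T : measurableType d) (R : realType)
  (P : probability T R) (k : nat) (Z : T -> nat) (X : 'I_k -> nat -> T -> nat) :
  (2 <= k)%N ->
  (* Z is a random variable with values in {1,2,3,...} *)
  (forall j : nat, measurable (Z @^-1` [set j])) ->
  P (Z @^-1` [set 0%N]) = 0%E ->
  (* the Z^{(i)}_n, n >= 1, are random variables distributed as Z *)
  (forall (i : 'I_k) (n j : nat), (0 < n)%N -> measurable (X i n @^-1` [set j])) ->
  (forall (i : 'I_k) (n j : nat), (0 < n)%N ->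
     P (X i n @^-1` [set j]) = P (Z @^-1` [set j])) ->
  (* and they are all mutually independent *)
  mutually_independent P (fun a : 'I_k * nat => (0 < a.2)%N)
    (fun a => X a.1 a.2) ->
  (* aperiodicity: gcd of the support of Z is 1 *)
  (forall q : nat, (forall j : nat, (0 < P (Z @^-1` [set j]))%E -> (q %| j)%N) ->
     q = 1%N) ->
  (* E Z = infinity *)
  (\int[P]_w ((Z w)%:R : R)%:E = +oo)%E ->
  (* E min(Z^{(1)},...,Z^{(k)}) < infinity, with independent copies
     Z^{(i)} := Z^{(i)}_1 *)
  (\int[P]_w (\big[mine/+oo%E]_(i < k) ((X i 1%N w)%:R : R)%:E) < +oo)%E ->
  (* Lambda_n -> infinity almost surely *)
  {ae P, forall w, Lambda_to_infty (fun i n => X i n w)}.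
Proof.
move=> k2 mZ Z0 mX lawX1 indX gcdZ EZ Emin.
have i0 : 'I_k := Ordinal (ltnW k2).
pose J := [set a : 'I_k * nat | (0 < a.2)%N].
pose Xf := fun a : 'I_k * nat => X a.1 a.2.
have mXf a j : J a -> measurable (Xf a @^-1` [set j]) by move=> /= Ja; exact: mX.
have lawX i n (B : set nat) : (0 < n)%N -> P (X i n @^-1` B) = P (Z @^-1` B).
  by move=> n0; apply: preimage_law => // j; [exact: mX|exact: lawX1].
pose S : set nat := [set j | (0 < P (Z @^-1` [set j]))%E].
have S0 j : S j -> (0 < j)%N by case: j => //; rewrite /S/= Z0 ltxx.
have [N SN] := semigroup_gen_eventually (S := S) gcdZ.
have /choice[sigma Hsig] : forall j, exists s, S s /\ ((0 < j)%N -> semigroup_gen S j ->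
    (s <= j)%N /\ semigroup_gen S (j - s)%N).
  move=> j; have [|nSj] := pselect ((0 < j)%N /\ semigroup_gen S j).
    by move=> [j0 Sj]; have [s [Ss sj Sjs]] := semigroup_gen_pred Sj j0; exists s.
  (* For the other [j] the default is some point of the support, taken from [N.+1], so that
     [sigma j] always has positive probability. *)
  have [s [Ss _ _]] := semigroup_gen_pred (SN N.+1 (leqnSn N)) isT.
  by exists s; split=> // j0 Sj; exfalso; apply: nSj.
have spre (J' : set ('I_k * nat)) i n B : J' (i, n) -> sigma_gen Xf J' (X i n @^-1` B).
  exact: (@sigma_gen_preimage _ _ Xf J' (i, n)).
have mmin c : measurable [set w | forall i, (c < X i 1%N w)%N].
  rewrite (_ : [set w | _] = \bigcap_(i in [set: 'I_k]) (X i 1%N @^-1` [set x | (c < x)%N])).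
    apply: fin_bigcap_measurable => // i _; apply: (measurable_sigma_gen mXf).
    exact: spre.
  by apply/seteqP; split=> w H i; [move=> _; exact: H|exact: (H i I)].
have [w0 Hw0] : exists w0, (\sum_(w0.+1 <= m <oo)
    P [set w | forall i, (m < X i 1%N w)%N] <= (1 / 2 : R)%:E)%E.
  apply: nneseries_tail_small => //.
  by move: Emin; rewrite (expectation_min_tail P i0 (Y := fun i => X i 1%N)).
have sig0 j : (0 < P (Z @^-1` [set sigma j]))%E by have [] := Hsig j.
have [p p0 Hp] := prob_good_ge (sigma := sigma) (w0 := w0) i0 N mX lawX indX sig0 Hw0.
(* Jumps exist only at positive times, hence the shift: index [r] stands for time [r.+1], in
   accordance with the rank [a.2.-1]. In [F K r] the jump lands at or below [-K]. *)
pose G r := [set w | good i0 sigma N w0 r.+1 (fun i n => X i n w)].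
pose F K r := X i0 r.+1 @^-1` [set x | (r.+1 + K <= x)%N].
have limsup1 K : P (lim_sup_set (fun r => F K r `&` G r)) = 1%E.
  apply: (limsup_decoupled (rank := fun a => a.2.-1) (p := p) mXf indX) => //.
  - move=> r; exact: spre.
  - move=> r; have [_] := Hp r.+1; by apply: sigma_genS => -[i [|n]].
  - by move=> r; have [] := Hp r.+1.
  (* Since [r.+1 + K <= x] is [r + K < x], this is the tail series of the infinite expectation of
     [Z], shifted by [K]. *)
  - rewrite -[RHS](@nneseries_pinfty_shift R (fun c => P [set w | (c < Z w)%N]) K)//.
    + apply: eq_eseriesr => r _; rewrite lawX//; congr (P _).
    + move=> n; rewrite -/(Z @^-1` [set x | (n < x)%N]) -(lawX i0 1%N)//.
      rewrite (le_lt_trans (probability_le1 P _)) ?ltry//.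
      apply: (measurable_sigma_gen mXf).
      exact: spre.
    + rewrite -expectation_nat_tail// => c.
      rewrite (_ : [set w | _] = \bigcup_(j in [set x | (c < x)%N]) (Z @^-1` [set j])).
        by apply: bigcup_measurable.
      by apply/seteqP; split=> [w cw|w [j cj /= ->]//]; exists (Z w).
have mlim K : measurable (lim_sup_set (fun r => F K r `&` G r)).
  apply: bigcapT_measurable => n; apply: bigcup_measurable => r _; apply: measurableI.
    apply: (measurable_sigma_gen mXf).
    exact: spre.
  apply: (measurable_sigma_gen _ (proj2 (Hp r.+1))) => a j /= ra; apply: mX.
  exact: leq_ltn_trans ra.
have aelim : {ae P, forall w, forall K, lim_sup_set (fun r => F K r `&` G r) w}.
  apply: ae_foralln => K.
  exists (~` lim_sup_set (fun r => F K r `&` G r)); split=> //.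
    exact: measurableC.
  by apply: (eq_trans (probability_setC P (mlim K))); rewrite limsup1 subee.
(* Jumps are positive only almost surely; countably many null events are discarded. *)
have aepos : {ae P, forall w, forall i n, (0 < n)%N -> (0 < X i n w)%N}.
  apply: filter_forall => i; apply: ae_foralln => n.
  have [->|n0] := posnP n; first exact: aeW.
  exists (X i n @^-1` [set 0%N]); split; [exact: mX|exact: (eq_trans (lawX i n _ n0) Z0)|].
  by move=> w /= H; apply: contrapT => X0; apply: H => _; rewrite lt0n; apply/eqP.
apply: filterS2 aelim aepos => w Hlim Hpos.
apply: (@trunk_leaves k i0 N) => K.
have [r _ [Fr Gr]] := Hlim K 0%N I.
exists r.+1; split=> //.
apply: (good_inT (S := S) Hpos SN _ Gr) => j j0 Sj.
by have [Ss /(_ j0 Sj)[sj Sjs]] := Hsig j; split=> //; exact: S0.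
Qed.
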